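(* Let $X$ and $Y$ be completely regular topological spaces and let $f:X \times Y \to [-\infty, +\infty]$ be an extended real-valued function such that: (A1) for any $y \in Y$ the function $f(\cdot, y)$ is upper semicontinuous on $X$; (A2) the function $v_f$ is bounded above on $X$ and proper as a function with values in $\mathbb{R} \cup \{-\infty\}$; (A3) for any $x \in X$ the function $f(x,\cdot)$ is lower semicontinuous on $Y$; (A4) the function $w_f$ is bounded below on $Y$ and proper as a function with values in $\mathbb{R} \cup \{+\infty\}$. Let $\varepsilon'>0$, $\varepsilon''>0$, $x_0 \in X$ and $y_0 \in Y$ be such that $$v_f(x_0)>\sup_{x \in X} v_f(x) - \varepsilon', \qquad w_f(y_0)<\inf_{y \in Y} w_f(y) + \varepsilon''.$$ Then there exist continuous bounded functions $k: X \to \mathbb{R}_{+}$ and $r: Y \to \mathbb{R}_{+}$ such that $k(x_0)=r(y_0)=0$, $\|k\|_{\infty} < 2\varepsilon'+\varepsilon''+\Delta_f$, $\|r\|_{\infty} < \varepsilon'+2\varepsilon''+\Delta_f$, and the function $(x,y)\mapsto f(x,y)-k(x)+r(y)$ has a saddle point on $X\times Y$ at $(x_0,y_0)$.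
   Context: Completely regular spaces are assumed Hausdorff. $\mathbb{R}_+$ denotes the set of nonnegative real numbers; $\|\cdot\|_\infty$ is the supremum norm. For $f:X \times Y \to [-\infty, +\infty]$ put $v_f(x) := \inf_{y \in Y} f(x,y)$ for $x\in X$, $w_f(y) := \sup_{x \in X} f(x,y)$ for $y\in Y$, $V_f:=\sup_{x\in X} v_f(x)$, $W_f:=\inf_{y\in Y} w_f(y)$ and $\Delta_f := W_f-V_f=\inf_{y \in Y} \sup_{x \in X}f(x,y)-\sup_{x \in X} \inf_{y \in Y}f(x,y)$ (under (A1)--(A4) this is a finite nonnegative number). An extended real-valued function is proper if it takes a finite value at some point. A point $(x_0,y_0)\in X\times Y$ is a saddle point of a function $F$ on $X \times Y$ if $F(x,y_0) \leq F(x_0,y_0) \leq F(x_0,y)$ for all $x \in X$ and all $y \in Y$. *)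

(* Defs.v *)
From HB Require Import structures.
From mathcomp Require Import all_boot all_order all_algebra.
From mathcomp Require Import all_classical all_reals all_analysis.
Set Implicit Arguments.
Unset Strict Implicit.
Unset Printing Implicit Defensive.
Import Order.TTheory GRing.Theory Num.Theory numFieldNormedType.Exports.
Local Open Scope classical_set_scope.
Local Open Scope ring_scope.
Local Open Scope ereal_scope.

(* Mirror image of the library's [lower_semicontinuous]. *)
Definition upper_semicontinuous (R : realType) (X : topologicalType)
    (g : X -> \bar R) : Prop :=
  forall x (a : R), g x < a%:E ->
    exists2 U, nbhs x U & forall z, U z -> g z < a%:E.

Definition bounded_above (R : realType) (T : Type) (g : T -> \bar R) : Prop :=
  exists M : R, forall t, g t <= M%:E.

Definition bounded_below (R : realType) (T : Type) (g : T -> \bar R) : Prop :=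
  exists M : R, forall t, M%:E <= g t.

Definition proper_fun (R : realType) (T : Type) (g : T -> \bar R) : Prop :=
  exists t, g t \is a fin_num.

(* v_f *)
Definition inf_value (R : realType) (X Y : Type) (f : X -> Y -> \bar R)
    (x : X) : \bar R :=
  ereal_inf [set f x y | y in [set: Y]].

(* w_f *)
Definition sup_value (R : realType) (X Y : Type) (f : X -> Y -> \bar R)
    (y : Y) : \bar R :=
  ereal_sup [set f x y | x in [set: X]].

(* V_f *)
Definition supinf (R : realType) (X Y : Type) (f : X -> Y -> \bar R) : \bar R :=
  ereal_sup [set inf_value f x | x in [set: X]].

(* W_f *)
Definition infsup (R : realType) (X Y : Type) (f : X -> Y -> \bar R) : \bar R :=
  ereal_inf [set sup_value f y | y in [set: Y]].

(* Delta_f; only meaningful when W_f and V_f are finite, since the library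
   sets +oo - +oo = -oo - -oo = -oo. *)
Definition minimax_gap (R : realType) (X Y : Type) (f : X -> Y -> \bar R) :
    \bar R :=
  infsup f - supinf f.

Definition uniform_norm (R : realType) (T : Type) (g : T -> R) : \bar R :=
  ereal_sup [set (`|g t|%R)%:E | t in [set: T]].

Definition saddle_point (R : realType) (X Y : Type) (F : X -> Y -> \bar R)
    (x0 : X) (y0 : Y) : Prop :=
  forall x y, F x y0 <= F x0 y0 /\ F x0 y0 <= F x0 y.

(* Main.v *)
Require Import Defs.
From HB Require Import structures.
From mathcomp Require Import all_boot all_order all_algebra.
From mathcomp Require Import all_classical all_reals all_analysis.
From mathcomp Require Import lra.
Set Implicit Arguments.
Unset Strict Implicit.
Unset Printing Implicit Defensive.
Import Order.TTheory GRing.Theory Num.Theory numFieldNormedType.Exports.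
Local Open Scope classical_set_scope.
Local Open Scope ring_scope.
Local Open Scope ereal_scope.

(** The saddle inequalities decouple: with [k x0 = r y0 = 0] and
    [c = f x0 y0], they say that [k] dominates [f x y0 - c] and that [r]
    dominates [c - f x0 y].  Each of these two functions is upper
    semicontinuous, vanishes at the base point, and is bounded above by
    [w_f y0 - v_f x0], because [v_f x0 <= c <= w_f y0].  The near-optimality of
    [x0] and [y0] makes this bound smaller than [M = Delta_f + eps1 + eps2],
    which in turn is smaller than both required norm bounds.

    It remains to majorize an upper semicontinuous function [g <= c + M] with
    [g x0 = c] by [c + k], where [k] is continuous, takes its values in [0, M]
    and vanishes at [x0] ([usc_majorant]).  By upper semicontinuity and complete
    regularity there is, for every [n], a continuous [h n] from the space to
    [0, 1] that vanishes at [x0] and equals [1] wherever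
    [g >= c + M / 2 ^ (n + 1)] ([usc_cutoff]).  The function [k] is the sum of
    the series with terms [M / 2 ^ (n + 1) * h n].  The [n]-th partial sum plus
    the largest possible remainder [M / 2 ^ n] majorizes [g - c]: where [g] is
    at most [c + M / 2 ^ (n + 1)] the new remainder alone is large enough, and
    elsewhere [h n = 1], so that the new term makes up for the loss in the
    remainder. *)

(** * Dyadic series of cutoff functions *)

Section DyadicSeries.
Context {R : realType} {X : topologicalType}.
Variables (M : R) (h : nat -> X -> R).
Hypotheses (M_ge0 : (0 <= M)%R) (h01 : forall n x, (0 <= h n x <= 1)%R).

Definition dyadic_sum (n : nat) (x : X) : R :=
  (\sum_(i < n) M / 2 ^+ i.+1 * h i x)%R.

Definition dyadic_lim (x : X) : R := limn (dyadic_sum ^~ x).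

Let dyadic_ge0 n : (0 <= M / 2 ^+ n)%R.
Proof. by rewrite divr_ge0 // exprn_ge0. Qed.

Let dyadic_half n : (M / 2 ^+ n = M / 2 ^+ n.+1 + M / 2 ^+ n.+1)%R.
Proof. by rewrite exprS invfM; lra. Qed.

Let dyadic_sumS n x :
  (dyadic_sum n.+1 x = dyadic_sum n x + M / 2 ^+ n.+1 * h n x)%R.
Proof. by rewrite /dyadic_sum big_ord_recr. Qed.

Lemma dyadic_sum_nondecreasing x : nondecreasing_seq (dyadic_sum ^~ x).
Proof.
apply/nondecreasing_seqP => n; rewrite dyadic_sumS lerDl mulr_ge0 //.
by case/andP: (h01 n x).
Qed.

(** As [h n <= 1], each term is at most the drop from [M / 2 ^ n] to
    [M / 2 ^ (n + 1)].  Hence the limit lies between the [n]-th partial sum and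
    that sum plus [M / 2 ^ n], a bracket whose width is independent of [x]: this
    makes the convergence uniform. *)
Lemma dyadic_sum_remainder_nonincreasing x :
  nonincreasing_seq (fun n => dyadic_sum n x + M / 2 ^+ n)%R.
Proof.
apply/nonincreasing_seqP => n; rewrite dyadic_sumS (dyadic_half n).
have /andP[_ h1] := h01 n x.
have := ler_wpM2l (dyadic_ge0 n.+1) h1; rewrite mulr1; lra.
Qed.

Let dyadic_sum_le m n x : (dyadic_sum m x <= dyadic_sum n x + M / 2 ^+ n)%R.
Proof.
have [mn|/ltnW nm] := leqP m n.
  by rewrite (le_trans (dyadic_sum_nondecreasing x mn)) // lerDl.
apply: le_trans (dyadic_sum_remainder_nonincreasing x nm).
by rewrite lerDl.
Qed.

Lemma dyadic_sum_cvg x : cvgn (dyadic_sum ^~ x).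
Proof.
apply: nondecreasing_is_cvgn (dyadic_sum_nondecreasing x) _.
by exists (dyadic_sum 0 x + M / 2 ^+ 0)%R => _ [m _ <-].
Qed.

Lemma dyadic_lim_ge n x : (dyadic_sum n x <= dyadic_lim x)%R.
Proof.
apply: nondecreasing_cvgn_le; first exact: dyadic_sum_nondecreasing.
exact: dyadic_sum_cvg.
Qed.

Lemma dyadic_lim_le n x : (dyadic_lim x <= dyadic_sum n x + M / 2 ^+ n)%R.
Proof. by apply: limr_le; [exact: dyadic_sum_cvg|exact: nearW]. Qed.

Lemma dyadic_lim_itv x : (0 <= dyadic_lim x <= M)%R.
Proof.
have := dyadic_lim_ge 0 x; have := dyadic_lim_le 0 x.
by rewrite /dyadic_sum big_ord0 add0r expr0 divr1 => -> ->.
Qed.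

Lemma dyadic_remainder_small (e : R) : (0 < e)%R ->
  exists n, (M / 2 ^+ n < e)%R.
Proof.
move=> e0; have : (geometric M 2^-1 : R^nat) n @[n --> \oo] --> (0 : R)%R.
  by apply: cvg_geometric; rewrite ger0_norm // invf_lt1 // ltr1n.
move=> /cvgrPdist_lt/(_ _ e0)[n _ /(_ n (leqnn n))] /=.
rewrite sub0r normrN exprVn ger0_norm // => ?; by exists n.
Qed.

Lemma dyadic_lim_continuous : (forall n, continuous (h n)) ->
  continuous dyadic_lim.
Proof.
move=> ch x; apply/cvgrPdist_lt => e e0.
have e3 : (0 < e / 3)%R by rewrite divr_gt0.
have [n Mn] := dyadic_remainder_small e3.
have cS : continuous (dyadic_sum n).
  elim: n {Mn} => [|n IH] z.
    rewrite /dyadic_sum; under eq_fun do rewrite big_ord0.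
    exact: cvg_cst.
  rewrite (_ : dyadic_sum _ = fun y => dyadic_sum n y + M / 2 ^+ n.+1 * h n y)%R;
    last by apply/funext => y; exact: dyadic_sumS.
  by apply: cvgD; [exact: IH|apply: cvgM; [exact: cvg_cst|exact: ch]].
have /cvgrPdist_lt/(_ _ e3) := cS x.
apply: filterS => z; rewrite !ltr_norml => /andP[S1 S2].
have := dyadic_lim_ge n x; have := dyadic_lim_le n x.
have := dyadic_lim_ge n z; have := dyadic_lim_le n z.
by move=> ? ? ? ?; apply/andP; split; lra.
Qed.

Lemma dyadic_lim_eq0 x : (forall n, h n x = 0%R) -> dyadic_lim x = 0%R.
Proof.
move=> h0; rewrite /dyadic_lim (_ : dyadic_sum ^~ x = cst 0%R) ?lim_cst //.
by apply/funext => n; rewrite /dyadic_sum big1 // => i _; rewrite h0 mulr0.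
Qed.

(** The recursion behind the majorization: at each step, either the halved
    remainder still dominates [a], or the cutoff is [1] and the sum absorbs what
    the remainder loses. *)
Lemma dyadic_lim_majorant x (a : R) : (a <= M)%R ->
  (forall n, h n x = 1%R \/ (a < M / 2 ^+ n.+1)%R) -> (a <= dyadic_lim x)%R.
Proof.
move=> aM ha; have aS n : (a <= dyadic_sum n x + M / 2 ^+ n)%R.
  elim: n => [|n IH]; first by rewrite /dyadic_sum big_ord0 add0r expr0 divr1.
  case: (ha n) => [h1|/ltW an].
    by rewrite dyadic_sumS h1 mulr1 -addrA -dyadic_half.
  apply: le_trans an _; rewrite lerDr.
  by apply: sumr_ge0 => i _; rewrite mulr_ge0 //; case/andP: (h01 i x).
apply/ler_addgt0Pr => e e0; have [n Mn] := dyadic_remainder_small e0.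
have := aS n; have := dyadic_lim_ge n x; lra.
Qed.

End DyadicSeries.

(** * Continuous majorants of upper semicontinuous functions *)

Section Majorant.
Context {R : realType} {X : topologicalType}.

(** Upper semicontinuity makes [g < a] on a neighbourhood [U] of [x0]; complete
    regularity separates [x0] from the closed complement of its interior. *)
Lemma usc_cutoff (crX : completely_regular_space X) (g : X -> \bar R)
    (x0 : X) (a : R) : upper_semicontinuous g -> g x0 < a%:E ->
  exists h : X -> R, [/\ continuous h, forall x, (0 <= h x <= 1)%R, h x0 = 0%R &
    forall x, h x = 1%R \/ g x < a%:E].
Proof.
move=> uscg /uscg[U Ux0 Ug].
have clU : closed (~` U°) by apply: open_closedC; exact: open_interior.
have /(@uniform_separatorP _ R)[h [ch h01 h0 h1]] :
  uniform_separator [set x0] (~` U°) by apply: crX => //; apply.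
exists h; split => // [x||x].
- by have := h01 (h x) (imageT _ _); rewrite /= in_itv.
- by apply: (h0 (h x0)); exists x0.
- have [/interior_subset/Ug|nUx] := pselect (U° x); first by right.
  by left; apply: (h1 (h x)); exists x.
Qed.

(** Near [x0] the function [k] has to tend to [0] without falling below [g - c],
    so infinitely many levels are involved; each term of the dyadic series of
    cutoffs takes care of the points where [g - c] has one order of magnitude. *)
Lemma usc_majorant (crX : completely_regular_space X) (g : X -> \bar R)
    (x0 : X) (c M : R) : upper_semicontinuous g -> (0 < M)%R ->
  g x0 = c%:E -> (forall x, g x <= (c + M)%:E) ->
  exists k : X -> R, [/\ continuous k, forall x, (0 <= k x <= M)%R,
    k x0 = 0%R & forall x, g x <= (c + k x)%:E].
Proof.
move=> uscg M0 gx0 gM.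
have /choice[h hP] : forall n, exists h : X -> R,
    [/\ continuous h, forall x, (0 <= h x <= 1)%R, h x0 = 0%R &
        forall x, h x = 1%R \/ g x < (c + M / 2 ^+ n.+1)%:E].
  move=> n; apply: usc_cutoff => //.
  by rewrite gx0 lte_fin ltrDl divr_gt0 // exprn_gt0.
have h01 n x : (0 <= h n x <= 1)%R by case: (hP n).
exists (dyadic_lim M h); split.
- by apply: dyadic_lim_continuous (ltW M0) h01 _ => n; case: (hP n).
- exact: dyadic_lim_itv (ltW M0) h01.
- by apply: dyadic_lim_eq0 => n; case: (hP n).
- move=> x; case gx: (g x) (gM x) => [a| |] //.
  + rewrite !lee_fin => aM; rewrite -lerBlDl.
    apply: (dyadic_lim_majorant (ltW M0) h01); first by lra.
    move=> n; have [_ _ _ /(_ x)] := hP n; rewrite gx lte_fin.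
    by case=> [->|?]; [left|right; lra].
  + by move=> _; rewrite leNye.
Qed.

End Majorant.

(** * Bounds and finiteness of the minimax values *)

Lemma bounded_fun_itv (R : realType) (T : Type) (g : T -> R) (M : R) :
  (forall t, (0 <= g t <= M)%R) -> bounded_fun g.
Proof.
move=> gM; exists M; split; first exact: num_real.
move=> N MN t _ /=; have /andP[g0 gtM] := gM t.
by rewrite ger0_norm // (le_trans gtM) // ltW.
Qed.

Lemma uniform_norm_le (R : realType) (T : Type) (g : T -> R) (M : R) :
  (forall t, (0 <= g t <= M)%R) -> uniform_norm g <= M%:E.
Proof.
move=> gM; apply: ge_ereal_sup => _ [t _ <-].
by have /andP[g0 gtM] := gM t; rewrite lee_fin ger0_norm.
Qed.

Lemma supinf_fin_num (R : realType) (X Y : Type) (f : X -> Y -> \bar R) :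
  bounded_above (inf_value f) -> proper_fun (inf_value f) ->
  supinf f \is a fin_num.
Proof.
move=> [M vM] [t vt]; rewrite fin_numE -ltNye -ltey; apply/andP; split.
  apply: (@lt_le_trans _ _ (inf_value f t)); last first.
    by apply: ereal_sup_ubound; exists t.
  by rewrite ltNye; move: vt; rewrite fin_numE => /andP[].
apply: (@le_lt_trans _ _ M%:E); last exact: ltry.
by apply: ge_ereal_sup => _ [x _ <-].
Qed.

Lemma infsup_fin_num (R : realType) (X Y : Type) (f : X -> Y -> \bar R) :
  bounded_below (sup_value f) -> proper_fun (sup_value f) ->
  infsup f \is a fin_num.
Proof.
move=> [M wM] [t wt]; rewrite fin_numE -ltNye -ltey; apply/andP; split.
  apply: (@lt_le_trans _ _ M%:E); first exact: ltNyr.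
  by apply: le_ereal_inf_tmp => _ [y _ <-].
apply: (@le_lt_trans _ _ (sup_value f t)).
  by apply: ereal_inf_lbound; exists t.
by rewrite ltey; move: wt; rewrite fin_numE => /andP[].
Qed.

(** * The perturbed saddle point *)

Theorem theorem3p3 (R : realType) (X Y : topologicalType)
    (crX : completely_regular_space X) (hX : hausdorff_space X)
    (crY : completely_regular_space Y) (hY : hausdorff_space Y)
    (f : X -> Y -> \bar R)
    (A1 : forall y, upper_semicontinuous (fun x => f x y))
    (A2 : bounded_above (inf_value f) /\ proper_fun (inf_value f))
    (A3 : forall x, lower_semicontinuous (fun y => f x y))
    (A4 : bounded_below (sup_value f) /\ proper_fun (sup_value f))
    (eps1 eps2 : R) (eps1_gt0 : (0 < eps1)%R) (eps2_gt0 : (0 < eps2)%R)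
    (x0 : X) (y0 : Y)
    (hx0 : supinf f - eps1%:E < inf_value f x0)
    (hy0 : sup_value f y0 < infsup f + eps2%:E) :
  exists (k : X -> R) (r : Y -> R),
    [/\ [/\ continuous k, bounded_fun k & forall x, (0 <= k x)%R],
        [/\ continuous r, bounded_fun r & forall y, (0 <= r y)%R],
        k x0 = 0%R /\ r y0 = 0%R,
        uniform_norm k < (2 * eps1 + eps2)%:E + minimax_gap f /\
        uniform_norm r < (eps1 + 2 * eps2)%:E + minimax_gap f &
        saddle_point (fun x y => f x y - (k x)%:E + (r y)%:E) x0 y0].
Proof.
have /fineK := supinf_fin_num A2.1 A2.2.
have /fineK := infsup_fin_num A4.1 A4.2.
rewrite /minimax_gap; set W := fine _ => EW; set V := fine _ => EV.
rewrite -EW -EV in hx0 hy0 *.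
have vf y : inf_value f x0 <= f x0 y by apply: ereal_inf_lbound; exists y.
have wf x : f x y0 <= sup_value f y0 by apply: ereal_sup_ubound; exists x.
have lo y : (V - eps1)%:E <= f x0 y by rewrite EFinB (le_trans (ltW hx0)).
have up x : f x y0 <= (W + eps2)%:E by rewrite EFinD (le_trans _ (ltW hy0)).
have [c Ec] : exists c, f x0 y0 = c%:E.
  by move: (lo y0) (up x0); case: (f x0 y0) => [c| |] //; exists c.
have c_lt : (c < W + eps2)%R.
  by rewrite -lte_fin -Ec EFinD (le_lt_trans (wf x0)).
have c_gt : (V - eps1 < c)%R.
  by rewrite -lte_fin -Ec EFinB (lt_le_trans _ (vf y0)).
(* Strictly larger than sup_value f y0 - inf_value f x0, hence positive even
   when that difference is zero. *)
pose M := (W - V + eps1 + eps2)%R.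
have M0 : (0 < M)%R by rewrite /M; lra.
have [k [ck kM k0 fk]] : exists k : X -> R,
    [/\ continuous k, forall x, (0 <= k x <= M)%R,
        k x0 = 0%R & forall x, f x y0 <= (c + k x)%:E].
  apply: (usc_majorant crX (A1 y0) M0 Ec) => x.
  by rewrite (le_trans (up x)) // lee_fin /M; lra.
have usc_opp : upper_semicontinuous (fun y => - f x0 y).
  move=> y a; rewrite lteNl -EFinN => /A3[U Uy Ua].
  by exists U => // z /Ua; rewrite lteNl -EFinN.
have [r [cr rM r0 fr]] : exists r : Y -> R,
    [/\ continuous r, forall y, (0 <= r y <= M)%R,
        r y0 = 0%R & forall y, - f x0 y <= (- c + r y)%:E].
  apply: (usc_majorant crY usc_opp M0) => [|y]; first by rewrite Ec.
  rewrite leeNl -EFinN (le_trans _ (lo y)) // lee_fin /M; lra.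
exists k, r; split => //.
- by split => // [|x]; [exact: bounded_fun_itv kM|case/andP: (kM x)].
- by split => // [|y]; [exact: bounded_fun_itv rM|case/andP: (rM y)].
- split.
    apply: le_lt_trans (uniform_norm_le kM) _.
    by rewrite -EFinB -EFinD lte_fin /M; lra.
  apply: le_lt_trans (uniform_norm_le rM) _.
  by rewrite -EFinB -EFinD lte_fin /M; lra.
- move=> x y; rewrite Ec k0 r0 !sube0 !adde0; split.
    by rewrite leeBlDr // -EFinD.
  have := fr y; case: (f x0 y) => [b| |] //=.
  + by rewrite -EFinD !lee_fin; lra.
  + by move=> _; rewrite addye // leey.
Qed.
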